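(* Let $\Gamma\subseteq\mathbf{GL}(n,\mathbb{Z})\ltimes\mathbb{Z}^n$ be a Bieberbach group, let $\pi\colon\Gamma\to\mathbf{GL}(n,\mathbb{Z})$, $\pi(A,a)=A$, and suppose that $\ker\pi=\{I\}\times L$ with $L\subseteq\mathbb{Z}^n$ is the maximal normal abelian subgroup of $\Gamma$. For every $A\in\pi(\Gamma)$ fix a preimage $(A,v_A)\in\pi^{-1}(A)$. Then $\Gamma$ contains a subgroup isomorphic to the Promislow group $P$ if and only if there exist $A,B\in\pi(\Gamma)\setminus\{I\}$ with $$A^2B=BA^{-2}\quad\text{and}\quad B^2A=AB^{-2}$$ such that, with $v=v_A$ and $w=v_B$, the linear system $$\begin{bmatrix} P_1(A,B) & P_2(A,B) \\ P_2(B,A) & P_1(B,A) \end{bmatrix} \begin{bmatrix} x \\ y \end{bmatrix} = -\begin{bmatrix} P_1(A,B) & P_2(A,B) \\ P_2(B,A) & P_1(B,A) \end{bmatrix} \begin{bmatrix} v \\ w \end{bmatrix}$$ has an integral solution $x,y\in L$. Thus checking all such pairs $(A,B)$ is a correct procedure to decide whether $\Gamma$ contains a subgroup isomorphic to $P$.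
   Context: The multiplication in $\mathbf{GL}(n,\mathbb{Z})\ltimes\mathbb{Z}^n$ is $(A,a)(B,b)=(AB,a+Ab)$, and $I$ is the identity matrix. A group $G$ is a Bieberbach group if it is torsion-free and contains an abelian normal subgroup $T\simeq\mathbb{Z}^m$ (for some $m$) of finite index such that $C_G(T)=T$. In particular $\pi(\Gamma)\simeq\Gamma/(\{I\}\times L)$ is finite. The Promislow group is $P=\langle x,y\mid x^{-1}y^2x=y^{-2},\ y^{-1}x^2y=x^{-2}\rangle$. $P_1(X,Y)=1+X+YX^{-1}+YX^{-2}$ and $P_2(X,Y)=-1+X^2$; evaluating at matrices, $1$ means $I$ and products are taken in the written order. *)

(* Defs.v *)
From HB Require Import structures.
From mathcomp Require Import all_boot all_order all_algebra.
From mathcomp Require Import boolp classical_sets.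

Set Implicit Arguments.
Unset Strict Implicit.
Unset Printing Implicit Defensive.

Import GRing.Theory.

Local Open Scope classical_set_scope.
Local Open Scope group_scope.

Section Subgroups.

Variable G : groupType.
Implicit Types H T Gam : set G.

Definition subgroup H := H 1 /\ forall x y, H x -> H y -> H (x * y^-1).

Definition abelian_set H := forall x y, H x -> H y -> commute x y.

Definition normal_subgroup T Gam :=
  [/\ subgroup T, T `<=` Gam & forall g t, Gam g -> T t -> T (t ^ g)].

Definition centralizer_in Gam T : set G :=
  [set g | Gam g /\ forall t, T t -> commute g t].

Definition torsion_free Gam :=
  forall g k, Gam g -> (0 < k)%N -> g ^+ k = 1 -> g = 1.

(* Finitely many left cosets r T cover Gam. *)
Definition finite_index T Gam :=
  exists s : seq G, forall g, Gam g -> exists2 r, r \in s & T (r^-1 * g).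

Definition free_abelian_of_rank (m : nat) T :=
  exists f : 'cV[int]_m -> G,
    [/\ {morph f : a b / (a + b)%R >-> a * b}, injective f & range f = T].

Definition bieberbach Gam :=
  [/\ subgroup Gam, torsion_free Gam &
    exists T m,
      [/\ abelian_set T, normal_subgroup T Gam, free_abelian_of_rank m T,
          finite_index T Gam & centralizer_in Gam T = T]].

Definition maximal_normal_abelian T Gam :=
  [/\ normal_subgroup T Gam, abelian_set T &
    forall N, normal_subgroup N Gam -> abelian_set N -> T `<=` N -> N = T].

Definition contains_copy_of (P : groupType) Gam :=
  exists H, [/\ subgroup H, H `<=` Gam &
    exists f : {multiplicative P -> G}, injective f /\ range f = H].

End Subgroups.

(* The group <I | u = v for (u, v) in rels>, as the quotient of the words in
   the letters i and i^-1 by the congruence generated by free cancellation and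
   the given relations. The letter (i, b) stands for i if b is false, and for
   i^-1 if b is true. *)
Section Presentation.

Variables (I : choiceType) (rels : seq (seq (I * bool) * seq (I * bool))).

Notation word := (seq (I * bool)).

Definition letter_inv (a : I * bool) : I * bool := (a.1, ~~ a.2).

Definition word_inv (w : word) : word := rev (map letter_inv w).

Inductive word_eq : word -> word -> Prop :=
| WordRefl u : word_eq u u
| WordSym u v : word_eq u v -> word_eq v u
| WordTrans v u w : word_eq u v -> word_eq v w -> word_eq u w
| WordCat u u' v v' :
    word_eq u u' -> word_eq v v' -> word_eq (u ++ v) (u' ++ v')
| WordCancel a : word_eq [:: a; letter_inv a] [::]
| WordRel u v : (u, v) \in rels -> word_eq u v.

Definition word_eqb (u v : word) : bool := `[< word_eq u v >].

Lemma word_eqb_refl : reflexive word_eqb.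
Proof. by move=> u; apply/asboolP; exact: WordRefl. Qed.

Lemma word_eqb_sym : symmetric word_eqb.
Proof. by move=> u v; apply/asboolP/asboolP; exact: WordSym. Qed.

Lemma word_eqb_trans : transitive word_eqb.
Proof.
by move=> v u w /asboolP uv /asboolP vw; apply/asboolP; exact: WordTrans uv vw.
Qed.

Canonical word_equiv :=
  EquivRel word_eqb word_eqb_refl word_eqb_sym word_eqb_trans.

Local Open Scope quotient_scope.

Definition presented_group := {eq_quot word_equiv}.

HB.instance Definition _ := Choice.on presented_group.

Definition word_class (w : word) : presented_group := \pi_presented_group w.

Lemma word_classP u v : word_class u = word_class v <-> word_eq u v.
Proof.
split=> [/eqP|uv]; first by rewrite eqmodE => /asboolP.
by apply/eqP; rewrite eqmodE; apply/asboolP.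
Qed.

Lemma word_reprP w : word_eq (repr (word_class w)) w.
Proof. by apply/word_classP; rewrite /word_class reprK. Qed.

Definition pg_one : presented_group := word_class [::].
Definition pg_mul (p q : presented_group) : presented_group :=
  word_class (repr p ++ repr q).
Definition pg_inv (p : presented_group) : presented_group :=
  word_class (word_inv (repr p)).

Lemma letter_invK : involutive letter_inv.
Proof. by case=> i b; rewrite /letter_inv /= negbK. Qed.

Lemma word_mulV w : word_eq (w ++ word_inv w) [::].
Proof.
elim: w => [|a w IHw]; first exact: WordRefl.
rewrite /word_inv /= rev_cons -cats1 -/(word_inv w) catA.
apply: WordTrans (WordCancel a).
rewrite -[X in word_eq _ X]/([:: a] ++ [::] ++ [:: letter_inv a]).
rewrite -[X in word_eq X _]/
  ([:: a] ++ (w ++ word_inv w) ++ [:: letter_inv a]).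
apply: WordCat; first exact: WordRefl.
by apply: WordCat; [exact: IHw | exact: WordRefl].
Qed.

Lemma word_invK : involutive word_inv.
Proof.
by move=> w; rewrite /word_inv map_rev revK -map_comp map_id_in // => a _;
  exact: letter_invK.
Qed.

Lemma word_mulVw w : word_eq (word_inv w ++ w) [::].
Proof. by rewrite -{2}[w]word_invK; exact: word_mulV. Qed.

Lemma pg_mulA : associative pg_mul.
Proof.
elim/quotW=> u; elim/quotW=> v; elim/quotW=> w; apply/word_classP.
apply: WordTrans (WordCat (WordRefl _) (word_reprP _)) _.
rewrite catA; apply: WordCat; last exact: WordRefl.
by apply: WordSym; exact: word_reprP.
Qed.

Lemma pg_mul1 : left_id pg_one pg_mul.
Proof.
elim/quotW=> u; rewrite -[RHS]/(word_class u); apply/word_classP.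
rewrite -[X in word_eq _ X]cat0s.
by apply: WordCat; exact: word_reprP.
Qed.

Lemma pg_mulr1 : right_id pg_one pg_mul.
Proof.
elim/quotW=> u; rewrite -[RHS]/(word_class u); apply/word_classP.
rewrite -[X in word_eq _ X]cats0.
by apply: WordCat; exact: word_reprP.
Qed.

Lemma pg_mulV : left_inverse pg_one pg_inv pg_mul.
Proof.
move=> p; apply/word_classP; apply: WordTrans (word_mulVw (repr p)).
by apply: WordCat; [exact: word_reprP | exact: WordRefl].
Qed.

Lemma pg_mulrV : right_inverse pg_one pg_inv pg_mul.
Proof.
move=> p; apply/word_classP; apply: WordTrans (word_mulV (repr p)).
by apply: WordCat; [exact: WordRefl | exact: word_reprP].
Qed.

HB.instance Definition _ := isGroup.Build presented_group
  pg_mulA pg_mul1 pg_mulr1 pg_mulV pg_mulrV.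

End Presentation.

(* <x, y | x^-1 y^2 x = y^-2, y^-1 x^2 y = x^-2>, with x = false, y = true. *)
Definition promislow_relations : seq (seq (bool * bool) * seq (bool * bool)) :=
  let x := [:: (false, false)] in let y := [:: (true, false)] in
  [:: (word_inv x ++ y ++ y ++ x, word_inv (y ++ y));
      (word_inv y ++ x ++ x ++ y, word_inv (x ++ x))].

Definition promislow_group := presented_group promislow_relations.
HB.instance Definition _ := Group.on promislow_group.

Section GLZ.

Variable n : nat.

Record GLZ := MkGLZ { glmx :> 'M[int]_n; glmx_unit : glmx \in unitmx }.

HB.instance Definition _ := [isSub for glmx].
HB.instance Definition _ := [Choice of GLZ by <:].

Definition glz_one : GLZ := MkGLZ (unitmx1 _ _).
Lemma glz_mul_unit (A B : GLZ) : (glmx A *m glmx B)%R \in unitmx.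
Proof. by rewrite unitmx_mul !glmx_unit. Qed.
Definition glz_mul (A B : GLZ) : GLZ := MkGLZ (glz_mul_unit A B).
Lemma glz_inv_unit (A : GLZ) : invmx A \in unitmx.
Proof. by rewrite unitmx_inv glmx_unit. Qed.
Definition glz_inv (A : GLZ) : GLZ := MkGLZ (glz_inv_unit A).

Lemma glz_mulA : associative glz_mul.
Proof. by move=> A B C; apply/val_inj; exact: mulmxA. Qed.
Lemma glz_mul1 : left_id glz_one glz_mul.
Proof. by move=> A; apply/val_inj; exact: mul1mx. Qed.
Lemma glz_mulr1 : right_id glz_one glz_mul.
Proof. by move=> A; apply/val_inj; exact: mulmx1. Qed.
Lemma glz_mulV : left_inverse glz_one glz_inv glz_mul.
Proof. by move=> A; apply/val_inj; exact/mulVmx/glmx_unit. Qed.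
Lemma glz_mulrV : right_inverse glz_one glz_inv glz_mul.
Proof. by move=> A; apply/val_inj; exact/mulmxV/glmx_unit. Qed.

HB.instance Definition _ := isGroup.Build GLZ
  glz_mulA glz_mul1 glz_mulr1 glz_mulV glz_mulrV.

(* The semidirect product of GLZ and the column vectors Z^n. *)
Record affZ := Aff { lin : GLZ; trans : 'cV[int]_n }.

Definition aff_pair (g : affZ) := (lin g, trans g).
Definition pair_aff (p : GLZ * 'cV[int]_n) := Aff p.1 p.2.
Lemma aff_pairK : cancel aff_pair pair_aff. Proof. by case. Qed.
HB.instance Definition _ := Choice.copy affZ (can_type aff_pairK).

Definition aff_one : affZ := Aff 1 0%R.
Definition aff_mul (g h : affZ) : affZ :=
  Aff (lin g * lin h) (trans g + lin g *m trans h)%R.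
Definition aff_inv (g : affZ) : affZ :=
  Aff (lin g)^-1 (- ((lin g)^-1%g *m trans g))%R.

Lemma aff_mulA : associative aff_mul.
Proof.
move=> [A a] [B b] [C c]; congr Aff => /=; first exact: mulgA.
by rewrite mulmxDr addrA mulmxA.
Qed.
Lemma aff_mul1 : left_id aff_one aff_mul.
Proof. by move=> [A a]; congr Aff => /=; rewrite ?mul1g ?mul1mx ?add0r. Qed.
Lemma aff_mulr1 : right_id aff_one aff_mul.
Proof. by move=> [A a]; congr Aff => /=; rewrite ?mulg1 ?mulmx0 ?addr0. Qed.
Lemma aff_mulV : left_inverse aff_one aff_inv aff_mul.
Proof. by move=> [A a]; congr Aff => /=; rewrite ?mulVg ?addNr. Qed.
Lemma aff_mulrV : right_inverse aff_one aff_inv aff_mul.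
Proof.
move=> [A a]; congr Aff => /=; first by rewrite mulgV.
by rewrite mulmxN mulmxA mulmxV ?glmx_unit // mul1mx addrN.
Qed.

HB.instance Definition _ := isGroup.Build affZ
  aff_mulA aff_mul1 aff_mulr1 aff_mulV aff_mulrV.

Definition translations (L : set 'cV[int]_n) : set affZ :=
  [set Aff 1 l | l in L].

Definition P1 (X Y : GLZ) : 'M[int]_n :=
  (1%:M + X + Y *m (X^-1)%g + Y *m (X ^- 2)%g)%R.

Definition P2 (X Y : GLZ) : 'M[int]_n := (- 1%:M + (X ^+ 2)%g)%R.

Definition promislow_mx (A B : GLZ) : 'M[int]_(n + n) :=
  block_mx (P1 A B) (P2 A B) (P2 B A) (P1 B A).

Definition promislow_system (A B : GLZ) (v w x y : 'cV[int]_n) : Prop :=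
  (promislow_mx A B *m col_mx x y = - promislow_mx A B *m col_mx v w)%R.

End GLZ.

(* Membership in the Z-span of finitely many integer vectors; they are mapped to
   rational vectors only because [dec_Qint_span] is stated over rat. *)
Definition in_int_span (m : nat) (s : seq 'cV[int]_m) (u : 'cV[int]_m) : bool :=
  dec_Qint_span (in_tuple [seq map_mx (intr : int -> rat) x | x <- s])
                (map_mx (intr : int -> rat) u).

Definition generates (n : nat) (gens : seq 'cV[int]_n) (L : set 'cV[int]_n) :=
  L = [set u | inIntSpan (in_tuple gens) u].

(* [hol] lists pi(Gamma), [v] gives the chosen preimages and [gens] generates L.
   The system is solvable in L iff its right-hand side lies in the Z-span
   of the images of the vectors (l, 0) and (0, l) for l in [gens]. *)
Definition promislow_test (n : nat) (hol : seq (GLZ n))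
    (v : GLZ n -> 'cV[int]_n) (gens : seq 'cV[int]_n) : bool :=
  let solvable A B :=
    let M := promislow_mx A B in
    in_int_span ([seq (M *m col_mx l 0)%R | l <- gens] ++
                 [seq (M *m col_mx 0 l)%R | l <- gens])
                (- M *m col_mx (v A) (v B))%R in
  has (fun A => has (fun B =>
    [&& A != 1, B != 1, A ^+ 2 * B == B * A ^- 2, B ^+ 2 * A == A * B ^- 2
      & solvable A B]) hol) hol.

(* Main.v *)
Require Import Defs.
From HB Require Import structures.
From mathcomp Require Import all_boot all_order all_algebra.
From mathcomp Require Import boolp classical_sets.
From mathcomp Require Import zify.

Set Implicit Arguments.
Unset Strict Implicit.
Unset Printing Implicit Defensive.

Import GRing.Theory.

Local Open Scope classical_set_scope.
Local Open Scope group_scope.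

(** The Promislow group P is the Hantzsche-Wendt group: a^i b^j c^k, with
    a = x^2, b = y^2, c = (xy)^2, form a free abelian subgroup of index 4, on
    which x, y and xy act by changing two of the three signs each.

    Two facts reduce the theorem to linear algebra. The relations alone imply
    that every element generated by x and y has the form
    a^i b^j c^k x^e y^f with e, f in {0, 1} ([promislow_normal_form]). In a
    torsion-free group, if x and y are nontrivial and satisfy the relations,
    such an expression is trivial only when all its exponents vanish
    ([normal_form_eq1]): for t = a^i b^j c^k, the products t t^x, t t^y and
    t t^(xy) are even powers of a, b and c, whereas t = (x^e y^f)^-1 would
    make one of them an odd power unless e = f = 0. So a torsion-free group
    contains P as soon as it contains two nontrivial elements satisfying the
    relations, and conversely ([contains_promislowP]).

    For affine elements (A, a) and (B, b) the relations say that A and B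
    satisfy them and that (a, b) is killed by the block matrix of the system
    ([promislow_pair_affP]). The elements of Gamma over A are the
    (A, v_A + x) with x in L ([preimage_coset]), which produces the system.
    That x and y are nontrivial is equivalent to A <> I and B <> I: if A = I,
    then B^4 = I, so y^4 is a translation that commutes with the translation
    x, while x inverts it, whence y^8 = 1 ([lin_neq1_pair]).

    Finally, a normal abelian subgroup of Gamma lies in the
    self-centralizing lattice T of the definition of a Bieberbach group
    ([normal_abelian_sub]); by maximality the translations of Gamma are
    therefore exactly T. Hence the holonomy is finite, L is finitely
    generated, and the test enumerates all pairs, deciding each system by
    membership in the span of the images of the generators. *)

(** * Subgroups, morphisms and integer powers *)

Lemma subgroupM (G : groupType) (H : set G) g h :
  subgroup H -> H g -> H h -> H (g * h).
Proof.
move=> [H1 HD] Hg Hh; have := HD _ _ H1 Hh; rewrite mul1g => HhV.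
by have := HD _ _ Hg HhV; rewrite invgK.
Qed.

Lemma subgroupV (G : groupType) (H : set G) g : subgroup H -> H g -> H g^-1.
Proof. by move=> [H1 HD] Hg; rewrite -[g^-1]mul1g; exact: HD. Qed.

Lemma subgroupX (G : groupType) (H : set G) g m : subgroup H -> H g -> H (g ^+ m).
Proof.
by move=> sgH Hg; elim: m => [|m IHm]; [case: sgH | rewrite expgS; exact: subgroupM].
Qed.

Section IntegerPowers.

Variable G : groupType.
Implicit Types (g h : G) (i j : int).

Definition zpow g i : G :=
  match i with Posz n => g ^+ n | Negz n => g ^- n.+1 end.

Lemma zpow0 g : zpow g 0 = 1. Proof. by []. Qed.
Lemma zpow1 g : zpow g 1 = g. Proof. by []. Qed.
Lemma zpow_nat g n : zpow g (Posz n) = g ^+ n. Proof. by []. Qed.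

Lemma zpow_diff g (m n : nat) : zpow g (Posz m - Posz n)%R = g ^+ m * g ^- n.
Proof.
have [lenm|ltmn] := leqP n m.
  by rewrite subzn // zpow_nat expgnFr.
have -> : (Posz m - Posz n)%R = Negz (n - m).-1 by lia.
by rewrite /zpow prednK ?subn_gt0 // expgnFr 1?ltnW // invgF.
Qed.

Lemma int_diff i : exists m n : nat, i = (Posz m - Posz n)%R.
Proof.
by case: i => n; [exists n, 0%N | exists 0%N, n.+1]; lia.
Qed.

Lemma zpowD g i j : zpow g (i + j)%R = zpow g i * zpow g j.
Proof.
have [m [n ->]] := int_diff i; have [p [q ->]] := int_diff j.
have -> : (Posz m - Posz n + (Posz p - Posz q))%R = (Posz (m + p) - Posz (n + q))%R.
  by lia.
rewrite !zpow_diff !expgnDr invgM -!mulgA; congr (_ * _).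
have c : commute (g ^+ p) (g ^- q * g ^- n).
  apply: commuteM; apply: commuteV; apply: commuteX2; exact: commute_refl.
have c2 : commute (g ^- q) (g ^- n).
  apply: commuteV; apply: commute_sym; apply: commuteV.
  by apply: commuteX2; exact: commute_refl.
rewrite c c2 -mulgA; congr (_ * _); apply: commute_sym.
by apply: commuteV; apply: commuteX2; exact: commute_refl.
Qed.

Lemma zpowN g i : zpow g (- i)%R = (zpow g i)^-1.
Proof. by apply/esym/mulg1_eq; rewrite -zpowD subrr. Qed.

Lemma zpowV g i : zpow g^-1 i = zpow g (- i)%R.
Proof. by rewrite zpowN; case: i => n; rewrite /zpow expVgn. Qed.

Lemma zpowX g n i : zpow (g ^+ n) i = zpow g (Posz n * i)%R.
Proof.
have [p [q ->]] := int_diff i.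
by rewrite zpow_diff mulrBr -!PoszM zpow_diff !expgnA.
Qed.

Lemma zpowJ g h i : zpow g i ^ h = zpow (g ^ h) i.
Proof. by case: i => n; rewrite /zpow ?conjVg conjXg. Qed.

Lemma commute_zpow g h i : commute g h -> commute g (zpow h i).
Proof.
by move=> gh; case: i => n; [|apply: commuteV]; exact: commuteX.
Qed.

Lemma zpow_eq1 (H : set G) g i :
  torsion_free H -> H g -> g <> 1 -> zpow g i = 1 -> i = 0%R.
Proof.
move=> tfH Hg g_neq1; case: i => [[//|n]|n] /= gn1; case: g_neq1.
  exact: tfH gn1.
by apply: (tfH g n.+1) => //; apply/eqP; rewrite -invg_eq1 gn1.
Qed.

End IntegerPowers.

Section Morphisms.

Variables (G K : groupType) (f : G -> K).
Hypothesis fM : {morph f : g h / g * h}.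

Lemma morph_one : f 1 = 1.
Proof. by apply: (mulgI (f 1)); rewrite -fM !mulg1. Qed.

Lemma morph_inv g : f g^-1 = (f g)^-1.
Proof. by apply/esym/mulg1_eq; rewrite -fM mulgV morph_one. Qed.

Lemma morph_expg g n : f (g ^+ n) = f g ^+ n.
Proof. by elim: n => [|n IHn]; rewrite ?morph_one // !expgS fM IHn. Qed.

Lemma morph_zpow g i : f (zpow g i) = zpow (f g) i.
Proof. by case: i => n /=; rewrite ?morph_inv morph_expg. Qed.

End Morphisms.

(** * Normal forms of products of two generators *)

Definition promislow_pair (G : groupType) (x y : G) :=
  (x ^+ 2) ^ y = x ^- 2 /\ (y ^+ 2) ^ x = y ^- 2.

(** Locked because it is itself a product, which associativity rewriting would
    otherwise unfold. *)
HB.lock Definition lattice_elt (G : groupType) (x y : G) (i j k : int) : G :=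
  zpow (x ^+ 2) i * zpow (y ^+ 2) j * zpow ((x * y) ^+ 2) k.

Section NormalForm.

Variables (G : groupType) (x y : G).

Definition normal_form (i j k : int) (e f : bool) : G :=
  lattice_elt x y i j k * (x ^+ e * y ^+ f).

Hypothesis xy : promislow_pair x y.

Let a_y : (x ^+ 2) ^ y = x ^- 2. Proof. by case: xy. Qed.
Let b_x : (y ^+ 2) ^ x = y ^- 2. Proof. by case: xy. Qed.

Lemma conj_inv_commute (g h : G) : g ^ h = g^-1 -> commute g (h ^+ 2).
Proof.
by move=> gh; rewrite /commute conjgC expg2 conjgM gh conjVg gh invgK.
Qed.

Let xbV : x * y ^- 2 = y ^+ 2 * x.
Proof. by rewrite [RHS]conjgC b_x. Qed.

Let xb : x * y ^+ 2 = y ^- 2 * x.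
Proof. by apply: (mulgI (y ^+ 2)); rewrite mulVKg mulgA -xbV mulgVK. Qed.

Let ya : y * x ^+ 2 = x ^- 2 * y.
Proof.
by apply: (mulgI (x ^+ 2)); rewrite mulVKg mulgA [_ * y]conjgC a_y mulgVK.
Qed.

(** Exchanging the two generators costs an element of the lattice: with the
    relations, y x = (xy)^-2 x^-2 y^2 (x y). *)
Lemma swap_generators :
  (x * y) ^+ 2 * (y * x) = x ^- 2 * y ^+ 2 * (x * y).
Proof.
have cV (g : G) : g * g ^- 2 = g ^- 2 * g.
  by apply: commuteV; apply: commuteX; exact: commute_refl.
have -> : (x * y) ^+ 2 * (y * x) = x * (y * (x * y ^+ 2) * x).
  by rewrite !expg2 !mulgA.
rewrite xb.
have -> : x * (y * (y ^- 2 * x) * x) = x * y ^- 2 * (y * x ^+ 2).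
  by rewrite (expg2 x) (mulgA y) cV !mulgA.
have ab : y ^+ 2 * x ^- 2 = x ^- 2 * y ^+ 2.
  by apply: commuteV; apply: commute_sym; exact: conj_inv_commute.
by rewrite xbV ya mulgA -(mulgA _ x) cV mulgA ab -(mulgA (_ * _)).
Qed.

(** The squares of xy and yx, which are conjugate under x and under y, are
    inverse to each other; so both x and y invert (xy)^2. *)
Lemma square_swapped : (x * y) ^+ 2 * (y * x) ^+ 2 = 1.
Proof.
rewrite [X in _ * X]expg2 mulgA swap_generators.
have -> : x ^- 2 * y ^+ 2 * (x * y) * (y * x) = x ^- 2 * y ^+ 2 * (x * y ^+ 2) * x.
  by rewrite !expg2 !mulgA.
by rewrite xb mulgA mulgK -mulgA -expg2 mulVg.
Qed.

Lemma xy2_conj_x : ((x * y) ^+ 2) ^ x = (x * y) ^- 2.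
Proof.
rewrite (mulg1_eq square_swapped) conjXg; congr (_ ^+ _).
by rewrite conjgE -mulgA mulKg.
Qed.

Lemma xy2_conj_y : ((x * y) ^+ 2) ^ y = (x * y) ^- 2.
Proof.
apply: invg_inj; rewrite -conjVg invgK (mulg1_eq square_swapped) conjXg.
by rewrite conjgE -mulgA mulKg.
Qed.

Let commute_ab : commute (x ^+ 2) (y ^+ 2).
Proof. exact: conj_inv_commute. Qed.
Let commute_ac : commute (x ^+ 2) ((x * y) ^+ 2).
Proof. apply: commute_sym; exact: conj_inv_commute xy2_conj_x. Qed.
Let commute_bc : commute (y ^+ 2) ((x * y) ^+ 2).
Proof. apply: commute_sym; exact: conj_inv_commute xy2_conj_y. Qed.

Lemma commute_zpow2 (g h : G) i j :
  commute g h -> commute (zpow g i) (zpow h j).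
Proof.
by move=> gh; apply/commute_zpow/commute_sym/commute_zpow/commute_sym.
Qed.

Lemma lattice_eltD i j k i' j' k' :
  lattice_elt x y i j k * lattice_elt x y i' j' k' =
  lattice_elt x y (i + i') (j + j') (k + k').
Proof.
rewrite lattice_elt.unlock !zpowD.
have ab := @commute_zpow2 _ _ i' j commute_ab.
have ac := @commute_zpow2 _ _ i' k commute_ac.
have bc := @commute_zpow2 _ _ j' k commute_bc.
rewrite -!mulgA; congr (_ * _); rewrite !mulgA -(mulgA _ _ (zpow _ i')) -ac.
rewrite mulgA -ab -!mulgA; congr (_ * (_ * _)).
by rewrite mulgA -bc -mulgA.
Qed.

Lemma lattice_eltJx i j k : lattice_elt x y i j k ^ x = lattice_elt x y i (- j) (- k).
Proof.
rewrite lattice_elt.unlock !conjMg !zpowJ b_x xy2_conj_x !zpowV; congr (zpow _ _ * _ * _).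
by rewrite conjXg conjgE mulKg.
Qed.

Lemma lattice_eltJy i j k : lattice_elt x y i j k ^ y = lattice_elt x y (- i) j (- k).
Proof.
rewrite lattice_elt.unlock !conjMg !zpowJ a_y xy2_conj_y !zpowV; congr (_ * zpow _ _ * _).
by rewrite conjXg conjgE mulKg.
Qed.

Lemma lattice_eltJxy i j k :
  lattice_elt x y i j k ^ (x * y) = lattice_elt x y (- i) (- j) k.
Proof. by rewrite conjgM lattice_eltJx lattice_eltJy opprK. Qed.

Lemma lattice_elt_x : lattice_elt x y 1 0 0 = x ^+ 2.
Proof. by rewrite lattice_elt.unlock !zpow0 !mulg1. Qed.

Lemma lattice_elt_y : lattice_elt x y 0 1 0 = y ^+ 2.
Proof. by rewrite lattice_elt.unlock !zpow0 mulg1 mul1g. Qed.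

Lemma swap_generators_lattice : y * x = lattice_elt x y (- 1) 1 (- 1) * (x * y).
Proof.
apply: (mulgI (lattice_elt x y 0 0 1)); rewrite [RHS]mulgA lattice_eltD.
rewrite {1}lattice_elt.unlock !zpow0 !mul1g zpow1 swap_generators.
by rewrite !add0r subrr lattice_elt.unlock zpow0 mulg1.
Qed.

Lemma lattice_elt_xV : lattice_elt x y (- 1) 0 0 = x ^- 2.
Proof. by rewrite lattice_elt.unlock !zpow0 !mulg1. Qed.

Lemma lattice_elt_yV : lattice_elt x y 0 (- 1) 0 = y ^- 2.
Proof. by rewrite lattice_elt.unlock !zpow0 mulg1 mul1g. Qed.

Lemma mul_lattice_elt_normal_form i j k i' j' k' e f :
  lattice_elt x y i j k * normal_form i' j' k' e f =
  normal_form (i + i') (j + j') (k + k') e f.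
Proof. by rewrite /normal_form mulgA lattice_eltD. Qed.

Lemma mulx_normal_form i j k e f :
  x * normal_form i j k e f = normal_form (i + Posz e)%R (- j) (- k) (~~ e) f.
Proof.
rewrite /normal_form.
have -> : lattice_elt x y i j k = lattice_elt x y i (- j) (- k) ^ x.
  by rewrite lattice_eltJx !opprK.
rewrite mulgA -conjgC -!mulgA (mulgA x) -expgS.
case: e => /=; last by rewrite addr0.
by rewrite -lattice_elt_x mul1g mulgA lattice_eltD !addr0.
Qed.

Lemma muly_normal_form i j k e f :
  y * normal_form i j k e f =
  normal_form (- i - Posz e)%R (j + Posz (e (+) f))%R (- k - Posz e)%R e (~~ f).
Proof.
rewrite /normal_form.
have -> : lattice_elt x y i j k = lattice_elt x y (- i) j (- k) ^ y.
  by rewrite lattice_eltJy !opprK.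
rewrite mulgA -conjgC -!mulgA.
case: e => /=; last first.
  rewrite !subr0 !mul1g -expgS; case: f => /=; last by rewrite addr0.
  by rewrite -lattice_elt_y mulg1 lattice_eltD !addr0.
rewrite (mulgA y) expg1 swap_generators_lattice -!mulgA -expgS.
rewrite (mulgA (lattice_elt x y (- i) _ _)) lattice_eltD.
case: f => //=; rewrite addr0 mulg1.
have -> : x * y ^+ 2 = lattice_elt x y 0 (-1) 0 * x.
  by rewrite xb lattice_elt_yV.
by rewrite mulgA lattice_eltD !addr0 addrK.
Qed.

Definition has_normal_form g := exists i j k e f, g = normal_form i j k e f.

Lemma has_normal_form1 : has_normal_form 1.
Proof.
exists 0%R, 0%R, 0%R, false, false.
by rewrite /normal_form lattice_elt.unlock !zpow0 !mulg1.
Qed.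

Lemma has_normal_form_x g : has_normal_form g -> has_normal_form (x * g).
Proof. by move=> [i [j [k [e [f ->]]]]]; rewrite mulx_normal_form; do 5!eexists. Qed.

Lemma has_normal_form_y g : has_normal_form g -> has_normal_form (y * g).
Proof. by move=> [i [j [k [e [f ->]]]]]; rewrite muly_normal_form; do 5!eexists. Qed.

Lemma has_normal_form_xV g : has_normal_form g -> has_normal_form (x^-1 * g).
Proof.
move=> /has_normal_form_x [i [j [k [e [f E]]]]].
have -> : x^-1 * g = lattice_elt x y (- 1) 0 0 * (x * g).
  by rewrite lattice_elt_xV expg2 invgM mulgA mulgVK.
by rewrite E mul_lattice_elt_normal_form; do 5!eexists.
Qed.

Lemma has_normal_form_yV g : has_normal_form g -> has_normal_form (y^-1 * g).
Proof.
move=> /has_normal_form_y [i [j [k [e [f E]]]]].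
have -> : y^-1 * g = lattice_elt x y 0 (- 1) 0 * (y * g).
  by rewrite lattice_elt_yV expg2 invgM mulgA mulgVK.
by rewrite E mul_lattice_elt_normal_form; do 5!eexists.
Qed.

Section TorsionFree.

Variable H : set G.
Hypotheses (sgH : subgroup H) (tfH : torsion_free H).
Hypotheses (Hx : H x) (Hy : H y) (x_neq1 : x <> 1) (y_neq1 : y <> 1).

(** If y = x^-1, then x commutes with y, which inverts x^2; so x^4 = 1. *)
Lemma mul_generators_neq1 : x * y <> 1.
Proof.
move=> /mulg1_eq y_def; case: x_neq1; apply: (tfH (k := 4)) => //.
have := a_y; rewrite -y_def conjXg conjgE invgK mulgV mulg1 => E.
by rewrite (expgnDr x 2 2) {1}E mulVg.
Qed.

(** Write t for the lattice part. Conjugation by g in {x, y, xy} inverts two of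
    the three powers in t, so t t^g is an even power of g^2. If t = g^-1, then
    t t^g = g^-2 is an odd power of g^2, which torsion-freeness excludes; if
    t = 1, the even power is trivial and so is its exponent. *)
Lemma normal_form_eq1 i j k e f :
  normal_form i j k e f = 1 -> [/\ i = 0, j = 0, k = 0, e = false & f = false]%R.
Proof.
have indep (g : G) m : H g -> g <> 1 -> zpow (g ^+ 2) m = 1 -> m = 0%R.
  by move=> Hg g1; rewrite zpowX => /(zpow_eq1 tfH Hg g1); lia.
have t_x : lattice_elt x y i j k * lattice_elt x y i j k ^ x = zpow (x ^+ 2) (i + i).
  by rewrite lattice_eltJx lattice_eltD !subrr lattice_elt.unlock !zpow0 !mulg1.
have t_y : lattice_elt x y i j k * lattice_elt x y i j k ^ y = zpow (y ^+ 2) (j + j).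
  by rewrite lattice_eltJy lattice_eltD !subrr lattice_elt.unlock !zpow0 mulg1 mul1g.
have t_xy : lattice_elt x y i j k * lattice_elt x y i j k ^ (x * y) =
    zpow ((x * y) ^+ 2) (k + k).
  by rewrite lattice_eltJxy lattice_eltD !subrr lattice_elt.unlock !zpow0 !mul1g.
have no_odd (g : G) m : H g -> g <> 1 -> lattice_elt x y i j k = g^-1 ->
    lattice_elt x y i j k * lattice_elt x y i j k ^ g <> zpow (g ^+ 2) (m + m).
  move=> Hg g1 ->; rewrite conjgE mulVg mulg1 -invgM => E.
  have /(indep g) : zpow (g ^+ 2) (m + m + 1)%R = 1.
    by rewrite zpowD -E zpow1 expg2 mulVg.
  by move=> /(_ Hg g1); lia.
have Hxy := subgroupM sgH Hx Hy.
move=> E; have t_def : lattice_elt x y i j k = (x ^+ e * y ^+ f)^-1.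
  by apply/eqP; rewrite -mulg_eq1; apply/eqP.
case: e f t_def {E} => [] [] /=; rewrite ?mulg1 ?mul1g ?expg1 => t_def.
- by case: (no_odd _ k Hxy mul_generators_neq1 t_def).
- by case: (no_odd _ i Hx x_neq1 t_def).
- by case: (no_odd _ j Hy y_neq1 t_def).
have t1 : lattice_elt x y i j k = 1 by rewrite t_def invg1.
have [zx zy zxy] : [/\ zpow (x ^+ 2) (i + i) = 1, zpow (y ^+ 2) (j + j) = 1 &
    zpow ((x * y) ^+ 2) (k + k) = 1].
  by rewrite -t_x -t_y -t_xy t1 !conj1g mulg1.
have := indep _ _ Hx x_neq1 zx; have := indep _ _ Hy y_neq1 zy.
have := indep _ _ Hxy mul_generators_neq1 zxy.
by split=> //; lia.
Qed.

End TorsionFree.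

End NormalForm.

Lemma morph_normal_form (G K : groupType) (f : G -> K) :
  {morph f : g h / g * h} -> forall x y i j k d e,
  f (normal_form x y i j k d e) = normal_form (f x) (f y) i j k d e.
Proof.
move=> fM x y i j k d e.
by rewrite /normal_form lattice_elt.unlock !fM !(morph_zpow fM) !(morph_expg fM) fM.
Qed.

(** * Evaluation of words and the presented group *)

Section Evaluation.

Variables (I : choiceType) (rels : seq (seq (I * bool) * seq (I * bool))).
Variables (G : groupType) (e : I -> G).

Definition eval_letter (a : I * bool) : G := if a.2 then (e a.1)^-1 else e a.1.

Definition eval_word (w : seq (I * bool)) : G := \prod_(a <- w) eval_letter a.

Lemma eval_word_cat u w : eval_word (u ++ w) = eval_word u * eval_word w.
Proof. exact: big_cat. Qed.

Lemma eval_word_eq :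
  (forall u w, (u, w) \in rels -> eval_word u = eval_word w) ->
  forall u w, word_eq rels u w -> eval_word u = eval_word w.
Proof.
move=> e_rels u w; elim=> {u w} [//|//|u w t _ -> //|u u' w w' _ + _|a|u w].
- by rewrite !eval_word_cat => -> ->.
- rewrite /eval_word big_cons big_seq1 big_nil /eval_letter /=.
  by case: a.2; rewrite ?mulVg ?mulgV.
- exact: e_rels.
Qed.

Lemma eval_word_in (H : set G) w :
  subgroup H -> (forall i, H (e i)) -> H (eval_word w).
Proof.
move=> sgH He.
rewrite /eval_word; elim/big_ind: _ => [|g h|[i []] _] /=; first by case: sgH.
- exact: subgroupM.
- exact/(subgroupV sgH)/He.
- exact: He.
Qed.

Definition presented_eval (p : presented_group rels) : G := eval_word (repr p).

Hypothesis e_rels : forall u w, (u, w) \in rels -> eval_word u = eval_word w.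

Lemma presented_eval_class w : presented_eval (word_class rels w) = eval_word w.
Proof. by apply/(eval_word_eq e_rels)/word_reprP. Qed.

Lemma presented_evalM : {morph presented_eval : p q / p * q}.
Proof. by move=> p q; rewrite presented_eval_class eval_word_cat. Qed.

End Evaluation.

Lemma eval_word_class (I : choiceType)
    (rels : seq (seq (I * bool) * seq (I * bool))) (w : seq (I * bool)) :
  eval_word (fun i => word_class rels [:: (i, false)]) w = word_class rels w.
Proof.
elim: w => [|[i b] w IHw]; first by rewrite /eval_word big_nil.
rewrite /eval_word big_cons -/(eval_word _ w) IHw.
have catE u t : word_class rels (u ++ t) = word_class rels u * word_class rels t.
  apply/word_classP/WordSym; apply: WordCat; exact: word_reprP.
rewrite -cat1s catE; congr (_ * _); case: b => //=.
apply: mulg1_eq; rewrite -catE.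
by apply/word_classP; exact: (WordCancel _ (i, false)).
Qed.

(** * Copies of the Promislow group in torsion-free groups *)

Lemma promislow_relationsP (G : groupType) (e : bool -> G) :
  (forall u w, (u, w) \in promislow_relations -> eval_word e u = eval_word e w)
  <-> promislow_pair (e false) (e true).
Proof.
have evalE x y : eval_word e [:: (x, true); (y, false); (y, false); (x, false)]
    = (e y ^+ 2) ^ e x.
  by rewrite /eval_word !big_cons big_nil /eval_letter /= mulg1 conjgE expg2 !mulgA.
have evalVE x : eval_word e [:: (x, true); (x, true)] = e x ^- 2.
  by rewrite /eval_word !big_cons big_nil /eval_letter /= mulg1 expg2 invgM.
split=> [e_rels|[exy eyx] u w].
  by split; rewrite -evalE -evalVE; apply: e_rels; rewrite !inE eqxx ?orbT.
by rewrite !inE => /orP[] /eqP [-> ->]; rewrite evalE evalVE.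
Qed.

Definition promislow_gen (i : bool) : promislow_group :=
  word_class promislow_relations [:: (i, false)].

Lemma promislow_gen_pair : promislow_pair (promislow_gen false) (promislow_gen true).
Proof.
apply/(promislow_relationsP promislow_gen) => u w uw.
rewrite [LHS]eval_word_class [RHS]eval_word_class.
exact/word_classP/WordRel.
Qed.

Lemma promislow_normal_form (p : promislow_group) :
  has_normal_form (promislow_gen false) (promislow_gen true) p.
Proof.
have -> : p = eval_word promislow_gen (repr p).
  by rewrite [RHS]eval_word_class /word_class reprK.
elim: (repr p) => [|[[] []] w IHw]; rewrite /eval_word ?big_nil ?big_cons.
- exact: has_normal_form1.
- exact: (has_normal_form_yV promislow_gen_pair).
- exact: (has_normal_form_y promislow_gen_pair).
- exact: (has_normal_form_xV promislow_gen_pair).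
- exact: (has_normal_form_x promislow_gen_pair).
Qed.

(** Every relation of the presentation contains each generator an even number
    of times on either side, so the parity of that number is an invariant of
    group elements. *)
Lemma promislow_gen_neq1 i : promislow_gen i <> 1.
Proof.
have parity u w : word_eq promislow_relations u w ->
    odd (count (fun a => a.1 == i) u) = odd (count (fun a => a.1 == i) w).
  elim=> {u w} // [u w t _ -> //|u u' w w' _ + _|a|u w].
  - by rewrite !count_cat !oddD => -> ->.
  - by rewrite /= addn0 oddD addbb.
  - by rewrite !inE => /orP[] /eqP [-> ->]; case: i.
by move=> /word_classP /parity /=; rewrite eqxx.
Qed.

(** Since every element of P has a normal form, the morphism sending the
    generators to x and y is injective by the independence of the exponents in
    the normal form, taken in the torsion-free target. *)
Theorem contains_promislowP (G : groupType) (H : set G) :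
  subgroup H -> torsion_free H ->
  contains_copy_of promislow_group H <->
  exists x y, [/\ H x, H y, x <> 1, y <> 1 & promislow_pair x y].
Proof.
move=> sgH tfH; split=> [[K [_ KH [f [f_inj fK]]]]|[x [y [Hx Hy x1 y1 xy]]]].
  have fM : {morph f : p q / p * q} by move=> p q; rewrite gmulfM.
  have Hf p : H (f p) by apply: KH; rewrite -fK; exists p.
  exists (f (promislow_gen false)), (f (promislow_gen true)).
  have f_neq1 i : f (promislow_gen i) <> 1.
    by rewrite -(morph_one fM) => /f_inj; exact: promislow_gen_neq1.
  split=> //; have [xy yx] := promislow_gen_pair.
  by split; rewrite conjgE -(morph_inv fM) -!(morph_expg fM) -(morph_inv fM);
     rewrite -!fM -conjgE ?xy ?yx.
pose e i := if i then y else x.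
have e_rels : forall u w, (u, w) \in promislow_relations ->
    eval_word e u = eval_word e w by apply/promislow_relationsP.
have fM := presented_evalM e_rels; set f := presented_eval _ in fM.
have f_gen i : f (promislow_gen i) = e i.
  by rewrite [LHS](presented_eval_class e_rels) /eval_word big_seq1.
have f_ker p : f p = 1 -> p = 1.
  have [i [j [k [d [d' ->]]]]] := promislow_normal_form p.
  rewrite (morph_normal_form fM) !f_gen.
  move=> /(normal_form_eq1 xy sgH tfH Hx Hy x1 y1) [-> -> -> -> ->].
  by rewrite /normal_form lattice_elt.unlock !zpow0 !mulg1.
have f_inj : injective f.
  move=> p q fpq; apply: divg1_eq; apply: f_ker.
  by rewrite fM (morph_inv fM) fpq mulgV.
pose F : {multiplicative promislow_group -> G} :=
  HB.pack f (isMultiplicative.Build promislow_group G f fM).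
have Hf p : H (f p) by apply: eval_word_in => // -[].
exists (range f); split.
- split; first by exists 1 => //; exact: morph_one fM.
  move=> _ _ [p _ <-] [q _ <-]; exists (p * q^-1) => //.
  by rewrite fM (morph_inv fM).
- by move=> _ [p _ <-].
- by exists F.
Qed.

(** * The relations for affine elements *)

Lemma conj_eqP (G : groupType) (g h : G) : g ^ h = g^-1 <-> g * h = h * g^-1.
Proof.
by split=> [gh|gh]; [rewrite conjgC gh | rewrite conjgE gh mulKg].
Qed.

Section Affine.

Variable n : nat.
Implicit Types (A B : GLZ n) (a b x y v w : 'cV[int]_n).

Lemma affZ_eqP A B a b : Aff A a = Aff B b <-> A = B /\ a = b.
Proof. by split=> [[-> ->]|[-> ->]]. Qed.

(** The relation g^2 h = h g^-2, for g = (A, a) and h = (B, b), is compared in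
    both components; since
    g^-2 has the vector part -(A^-1 a + A^-2 a), the vector parts agree
    exactly when P1 a + P2 b = 0. *)
Lemma aff_relationP A B a b :
  (Aff A a ^+ 2) ^ Aff B b = Aff A a ^- 2 <->
  A ^+ 2 * B = B * A ^- 2 /\ (P1 A B *m a + P2 A B *m b = 0)%R.
Proof.
rewrite conj_eqP; apply: (iff_trans (affZ_eqP _ _ _ _)) => /=.
have -> : (A * A)%g = (A ^+ 2)%g by [].
suff -> : (P1 A B *m a + P2 A B *m b =
  a + A *m a + (A ^+ 2)%g *m b - (b + B *m - ((A ^- 2)%g *m (a + A *m a))))%R.
  split=> -[-> E]; split=> //; first by rewrite E subrr.
  by apply/eqP; rewrite -subr_eq0; apply/eqP.
have AV : ((A ^- 2)%g *m A = (A^-1)%g :> 'M_n)%R.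
  have -> : ((A ^- 2)%g *m A)%R = glmx (A ^- 2 * A)%g by [].
  by rewrite expg2 invgM mulgVK.
rewrite /P1 /P2 !mulmxDl !mulNmx !mul1mx mulmxN mulmxDr [in RHS]mulmxDr !mulmxA.
rewrite -(mulmxA (glmx B) _ (glmx A)) AV opprB.
rewrite -!addrA; congr (_ + (_ + _))%R.
by rewrite addrCA [RHS]addrCA; congr (_ + _)%R; rewrite addrA addrC.
Qed.

Lemma promislow_systemP A B v w x y :
  promislow_system A B v w x y <->
  (P1 A B *m (x + v) + P2 A B *m (y + w) = 0 /\
   P1 B A *m (y + w) + P2 B A *m (x + v) = 0)%R.
Proof.
rewrite /promislow_system mulNmx.
have E : (promislow_mx A B *m col_mx x y + promislow_mx A B *m col_mx v w =
    col_mx (P1 A B *m (x + v) + P2 A B *m (y + w))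
           (P1 B A *m (y + w) + P2 B A *m (x + v)))%R.
  by rewrite -mulmxDr add_col_mx mul_block_col (addrC (P2 B A *m _)%R).
split=> [sys|[e1 e2]].
  move: E; rewrite sys addNr -[0%R]vsubmxK => /eq_col_mx [<- <-].
  by split; apply/matrixP => i j; rewrite !mxE.
by apply/eqP; rewrite -addr_eq0 E e1 e2 col_mx0.
Qed.

Lemma promislow_pair_affP A B v w x y :
  promislow_pair (Aff A (x + v)%R) (Aff B (y + w)%R) <->
  [/\ A ^+ 2 * B = B * A ^- 2, B ^+ 2 * A = A * B ^- 2 &
      promislow_system A B v w x y].
Proof.
split=> [[/aff_relationP[? ?] /aff_relationP[? ?]]|[? ? /promislow_systemP[? ?]]].
  by split=> //; apply/promislow_systemP.
by split; apply/aff_relationP.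
Qed.

End Affine.

(** * The translations of a Bieberbach group *)

Section Bieberbach.

Variables (n : nat) (Gam : set (affZ n)) (L : set 'cV[int]_n).
Hypothesis ker_lin : [set g | Gam g /\ lin g = 1] = translations L.

Lemma ker_linP g : Gam g -> lin g = 1 -> exists2 l, L l & g = Aff 1 l.
Proof.
move=> Gg g1; have : translations L g by rewrite -ker_lin.
by case=> l Ll <-; exists l.
Qed.

Lemma translation_in l : L l -> Gam (Aff 1 l).
Proof.
by move=> Ll; have : translations L (Aff 1 l) by [exists l]; rewrite -ker_lin; case.
Qed.

Lemma preimage_coset A a b : subgroup Gam -> Gam (Aff A b) ->
  Gam (Aff A a) <-> L (a - b)%R.
Proof.
move=> sgG Gb; have AE : Aff A a = Aff 1 (a - b)%R * Aff A b.
  by apply/affZ_eqP; rewrite mul1g /= mul1mx subrK.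
split=> [Ga|Lab]; last first.
  by rewrite AE; apply: subgroupM => //; exact: translation_in.
have [] := @ker_linP (Aff A a * (Aff A b)^-1).
- by case: sgG => _; apply.
- exact: mulgV.
- by move=> l Ll; rewrite AE mulgK => /affZ_eqP [_ ->].
Qed.

(** If g is a translation, the linear part of h has order dividing 4, so h^4
    is a translation too. It commutes with g, but g inverts it. *)
Lemma lin_neq1_pair g h : subgroup Gam -> torsion_free Gam ->
  Gam g -> Gam h -> h <> 1 -> promislow_pair g h -> lin g <> 1.
Proof.
move=> sgG tfG Gg Gh h1 [_ hg] /(ker_linP Gg) [l _ gE]; apply: h1.
have linM : {morph @lin n : x y / x * y} by [].
have trans_comm a : lin a = 1 -> commute a g.
  case: a => A a /= ->; rewrite gE; apply/affZ_eqP; split=> //=.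
  by rewrite !mul1mx addrC.
have lin_h4 : lin (h ^+ 4) = 1.
  have hg2 : h ^+ 2 * g = g * h ^- 2 by exact/conj_eqP.
  have E : lin (h ^+ 2) = lin (h ^- 2).
    by have := congr1 (@lin n) hg2; rewrite 2!linM gE mulg1 mul1g.
  rewrite [h ^+ 4](expgnDr h 2 2) linM {1}E (morph_inv linM); exact: mulVg.
apply: (tfG h 8) => //; rewrite [h ^+ 8](expgnDr h 4 4).
have h4_g : (h ^+ 4) ^ g = h ^- 4.
  by rewrite [h ^+ 4](expgnA h 2 2) conjXg hg expVgn.
by rewrite -{1}[h ^+ 4](mulKg g) -trans_comm // -conjgE h4_g mulVg.
Qed.

End Bieberbach.

(** By the pigeonhole principle, two powers of g lie in the same coset. *)
Lemma finite_index_power (G : groupType) (T H : set G) g :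
  subgroup H -> subgroup T -> finite_index T H -> H g ->
  exists2 k, (0 < k)%N & T (g ^+ k).
Proof.
move=> sgH sgT [s sP] Hg.
have /boolp.choice [c cP] (i : 'I_(size s).+1) :
    exists r : 'I_(size s), T ((nth 1 s r)^-1 * g ^+ i).
  have [r rs Tr] := sP _ (subgroupX i sgH Hg).
  by exists (Ordinal (etrans (index_mem r s) rs)); rewrite /= nth_index.
have [c_inj|] := pselect (injective c).
  by have := leq_card c c_inj; rewrite !card_ord ltnn.
move=> /existsNP [i /existsNP [j /not_implyP [cij /eqP ij]]].
wlog ltij : i j cij ij / (i < j)%N.
  move=> W; move: (ij); rewrite -val_eqE neq_ltn => /orP[|ltji]; first exact: W.
  by apply: (W j i) => //; rewrite eq_sym.
exists (j - i)%N; first by rewrite subn_gt0.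
have := subgroupM sgT (subgroupV sgT (cP i)) (cP j).
rewrite invgM invgK -cij -mulgA mulVKg expgnFr 1?ltnW //.
by rewrite commuteV //; apply: commute_sym; apply: commuteX2; exact: commute_refl.
Qed.

(** Let g be in N and t in T, and let g^k be in T. The commutator g^t g^-1 lies
    in N, so it commutes with g and its k-th power is (g^k)^t g^-k = 1. In a
    torsion-free group g therefore commutes with t, so g centralizes T. *)
Lemma normal_abelian_sub (G : groupType) (H T N : set G) :
  subgroup H -> torsion_free H -> normal_subgroup T H -> finite_index T H ->
  centralizer_in H T = T -> normal_subgroup N H -> abelian_set N -> N `<=` T.
Proof.
move=> sgH tfH [sgT TH nT] fiT cT [sgN NH nN] abN g Ng.
rewrite -cT; split=> [|t Tt]; first exact: NH.
have [k k_gt0 Tgk] := finite_index_power sgH sgT fiT (NH _ Ng).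
have abT t' : T t' -> commute t' t by rewrite -{1}cT => -[_]; exact.
have Ngt := nN _ _ (TH _ Tt) Ng.
have NgV := subgroupV sgN Ng.
have Nc : N (g ^ t * g^-1) by exact: subgroupM.
apply/commgP; rewrite -conjg_fix; apply/eqP/divg1_eq.
apply: (tfH _ k) => //; first exact: NH.
rewrite expgMn; last by apply: abN.
by rewrite -conjXg conjgE abT // mulKg expVgn mulgV.
Qed.

(** * Integer spans *)

Section IntegerSpan.

Variable V : zmodType.
Implicit Types (s t : seq V) (u : V).

Lemma int_span_nil u : inIntSpan (in_tuple [::]) u <-> u = 0%R.
Proof.
split=> [[c ->]|->]; first by rewrite big_ord0.
by exists [ffun=> 0%R]; rewrite big_ord0.
Qed.

Lemma int_span_cons x s u :
  inIntSpan (in_tuple (x :: s)) u <->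
  exists k w, inIntSpan (in_tuple s) w /\ u = (x *~ k + w)%R.
Proof.
split=> [[c ->]|[k [_ [[c ->] ->]]]].
  exists (c ord0), (\sum_(i < size s) s`_i *~ c (lift ord0 i))%R.
  split; last by rewrite big_ord_recl.
  by exists [ffun i => c (lift ord0 i)]; apply: eq_bigr => i _; rewrite ffunE.
exists [ffun i => if unlift ord0 i is Some j then c j else k].
rewrite big_ord_recl ffunE unlift_none; congr (_ + _)%R.
by apply: eq_bigr => i _; rewrite ffunE liftK.
Qed.

Lemma int_span_cat s t u :
  inIntSpan (in_tuple (s ++ t)) u <->
  exists a b, [/\ inIntSpan (in_tuple s) a, inIntSpan (in_tuple t) b & u = a + b]%R.
Proof.
elim: s u => [|x s IHs] u.
  split=> [tu|[a [b [/int_span_nil -> tb ->]]]]; last by rewrite add0r.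
  by exists 0%R, u; split=> //; [exact/int_span_nil | rewrite add0r].
split=> [/int_span_cons[k [w [/IHs [a [b [sa tb ->]]] ->]]]|].
  exists (x *~ k + a)%R, b; split=> //; last by rewrite addrA.
  by apply/int_span_cons; exists k, a.
move=> [_ [b [/int_span_cons[k [a [sa ->]]] tb ->]]].
apply/int_span_cons; exists k, (a + b)%R; split; last by rewrite addrA.
by apply/IHs; exists a, b.
Qed.

Lemma int_span_sum (I : Type) (r : seq I) (F : I -> V) (c : I -> int) :
  inIntSpan (in_tuple [seq F i | i <- r]) (\sum_(i <- r) F i *~ c i)%R.
Proof.
elim: r => [|i r IHr]; first by rewrite big_nil; exact/int_span_nil.
by rewrite big_cons; apply/int_span_cons; exists (c i); eexists; split; first exact: IHr.
Qed.

End IntegerSpan.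

Lemma int_span_map (U V : zmodType) (f : {additive U -> V}) (s : seq U) (u : V) :
  inIntSpan (in_tuple [seq f x | x <- s]) u <->
  exists2 w, inIntSpan (in_tuple s) w & u = f w.
Proof.
elim: s u => [|x s IHs] u.
  split=> [/int_span_nil ->|[w /int_span_nil -> ->]].
    by exists 0%R; [exact/int_span_nil | rewrite raddf0].
  by apply/int_span_nil; rewrite raddf0.
split=> [/int_span_cons[k [_ [/IHs[w sw ->] ->]]]|].
  exists (x *~ k + w)%R; last by rewrite raddfD raddfMz.
  by apply/int_span_cons; exists k, w.
move=> [_ /int_span_cons[k [w [sw ->]]] ->].
apply/int_span_cons; exists k, (f w); rewrite raddfD raddfMz; split=> //.
by apply/IHs; exists w.
Qed.

Lemma in_int_spanP (m : nat) (s : seq 'cV[int]_m) (u : 'cV[int]_m) :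
  in_int_span s u <-> inIntSpan (in_tuple s) u.
Proof.
have intr_inj : injective (map_mx (intr : int -> rat) : 'cV_m -> 'cV_m).
  move=> a b ab; apply/matrixP => i j; apply: (@intr_inj rat).
  by have := congr1 (fun M : 'cV_m => M i j) ab; rewrite !mxE.
apply: (@iff_trans _ (inIntSpan (in_tuple [seq map_mx (intr : int -> rat) x | x <- s])
   (map_mx intr u))).
  by rewrite /in_int_span; case: dec_Qint_span.
split=> [/int_span_map [w sw /intr_inj ->] //|su].
by apply/int_span_map; exists u.
Qed.

(** The images of the canonical basis vectors generate L. *)
Lemma free_abelian_generates (n m : nat) (L : set 'cV[int]_n) :
  free_abelian_of_rank m (translations L) -> exists gens, generates gens L.
Proof.
move=> [f [fD _ fL]].
have f_trans a : exists2 l, L l & f a = Aff 1 l.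
  have : translations L (f a) by rewrite -fL; exists a.
  by case=> l Ll <-; exists l.
have phiB : zmod_morphism (fun a => trans (f a)).
  have phiD a b : trans (f (a + b)%R) = (trans (f a) + trans (f b))%R.
    by have [l _ E] := f_trans a; rewrite fD E /= mul1mx.
  by move=> a b; have := phiD (a - b)%R b; rewrite subrK => ->; rewrite addrK.
pose phi : {additive 'cV[int]_m -> 'cV[int]_n} :=
  HB.pack (fun a => trans (f a)) (GRing.isZmodMorphism.Build _ _ _ phiB).
exists [seq phi x | x <- [seq (delta_mx i 0%R : 'cV_m) | i <- enum 'I_m]].
apply/seteqP; split=> [l Ll|l /int_span_map [w _ ->]]; last first.
  by have [l' Ll' fw] := f_trans w; rewrite /= fw.
have [w _ fw] : range f (Aff 1 l) by rewrite fL; exists l.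
apply/(int_span_map phi); exists w; last by rewrite /= fw.
have -> : w = (\sum_(i <- enum 'I_m) delta_mx i 0 *~ w i ord0)%R.
  rewrite big_enum /= {1}[w]matrix_sum_delta; apply: eq_bigr => i _.
  by rewrite big_ord1 -scaler_int intz.
exact: int_span_sum.
Qed.

(** The columns of the matrix split into two blocks, so the images of the
    vectors (l, 0) and (0, l) span the sum of the images of L under the two
    blocks. *)
Lemma promislow_mx_span (n : nat) (A B : GLZ n) (gens : seq 'cV[int]_n)
    (L : set 'cV[int]_n) (v w : 'cV[int]_n) :
  generates gens L ->
  in_int_span ([seq promislow_mx A B *m col_mx l 0 | l <- gens] ++
               [seq promislow_mx A B *m col_mx 0 l | l <- gens])%R
              (- promislow_mx A B *m col_mx v w)%R <->
  exists x y, [/\ L x, L y & promislow_system A B v w x y].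
Proof.
rewrite /promislow_system /generates => ->; set M := promislow_mx A B.
have lE : [seq M *m col_mx l 0 | l <- gens]%R = [seq mulmx (lsubmx M) l | l <- gens].
  by apply: eq_map => l; rewrite -{1}[M]hsubmxK mul_row_col mulmx0 addr0.
have rE : [seq M *m col_mx 0 l | l <- gens]%R = [seq mulmx (rsubmx M) l | l <- gens].
  by apply: eq_map => l; rewrite -{1}[M]hsubmxK mul_row_col mulmx0 add0r.
have ME x y : (M *m col_mx x y = lsubmx M *m x + rsubmx M *m y)%R.
  by rewrite -{1}[M]hsubmxK mul_row_col.
rewrite lE rE; split.
  move=> /in_int_spanP /int_span_cat [a [b [sa sb E]]].
  have [x sx aE] := (int_span_map _ _ _).1 sa.
  have [y sy bE] := (int_span_map _ _ _).1 sb.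
  by exists x, y; rewrite ME E aE bE.
move=> [x [y [sx sy E]]]; apply/in_int_spanP/int_span_cat => /=.
exists (lsubmx M *m x)%R, (rsubmx M *m y)%R; rewrite -E ME.
by split=> //; apply/int_span_map; [exists x | exists y].
Qed.

(** * The decision procedure *)

Theorem mainTheorem7 (n : nat) (Gam : set (affZ n)) (L : set 'cV[int]_n)
    (v : GLZ n -> 'cV[int]_n)
    (Gam_bieberbach : bieberbach Gam)
    (ker_lin : [set g | Gam g /\ lin g = 1] = translations L)
    (ker_max : maximal_normal_abelian (translations L) Gam)
    (v_preimage : forall A : GLZ n, (@lin n @` Gam) A -> Gam (Aff A (v A))) :
  (contains_copy_of promislow_group Gam <->
   exists A B : GLZ n,
     [/\ ((@lin n @` Gam) `\ 1) A, ((@lin n @` Gam) `\ 1) B,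
         A ^+ 2 * B = B * A ^- 2, B ^+ 2 * A = A * B ^- 2 &
         exists x y : 'cV[int]_n,
           [/\ L x, L y & promislow_system A B (v A) (v B) x y]])
  /\
  [/\ exists hol : seq (GLZ n), [set` hol] = @lin n @` Gam,
      exists gens : seq 'cV[int]_n, generates gens L &
      forall (hol : seq (GLZ n)) (gens : seq 'cV[int]_n),
        [set` hol] = @lin n @` Gam -> generates gens L ->
        (promislow_test hol v gens <-> contains_copy_of promislow_group Gam)].
Proof.
have [sgG tfG [T [m [abT nT freeT fiT cT]]]] := Gam_bieberbach.
have TE : T = translations L.
  have [nN abN maxN] := ker_max; apply: maxN => //.
  exact: normal_abelian_sub cT nN abN.
have copyP : contains_copy_of promislow_group Gam <->
   exists A B : GLZ n,
     [/\ ((@lin n @` Gam) `\ 1) A, ((@lin n @` Gam) `\ 1) B,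
         A ^+ 2 * B = B * A ^- 2, B ^+ 2 * A = A * B ^- 2 &
         exists x y : 'cV[int]_n,
           [/\ L x, L y & promislow_system A B (v A) (v B) x y]].
  apply: (iff_trans (contains_promislowP sgG tfG)); split.
    move=> [[A a] [[B b] [Ga Gb a1 b1 gh]]].
    have hA : (@lin n @` Gam) A by exists (Aff A a).
    have hB : (@lin n @` Gam) B by exists (Aff B b).
    have GA := v_preimage _ hA; have GB := v_preimage _ hB.
    have [] := (@promislow_pair_affP n A B (v A) (v B) (a - v A) (b - v B))%R.1.
      by rewrite !subrK.
    move=> AB BA sys; exists A, B; split=> //.
    - by split=> //; exact: (lin_neq1_pair ker_lin sgG tfG Ga Gb).
    - split=> //; apply: (lin_neq1_pair ker_lin sgG tfG Gb Ga) => //.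
      by case: gh.
    - exists (a - v A)%R, (b - v B)%R; split=> //.
        exact/(preimage_coset ker_lin a sgG GA).
      exact/(preimage_coset ker_lin b sgG GB).
  move=> [A [B [[hA A1] [hB B1] AB BA [x [y [Lx Ly sys]]]]]].
  exists (Aff A (x + v A)%R), (Aff B (y + v B)%R); split.
  - by apply/(preimage_coset ker_lin _ sgG (v_preimage _ hA)); rewrite addrK.
  - by apply/(preimage_coset ker_lin _ sgG (v_preimage _ hB)); rewrite addrK.
  - by move=> /(congr1 (@lin n)).
  - by move=> /(congr1 (@lin n)).
  - exact/promislow_pair_affP.
split=> //; split.
- have [s sP] := fiT.
  exists [seq A <- [seq lin r | r <- s] | `[< (@lin n @` Gam) A >]].
  apply/seteqP; split=> [A /=|A hA /=]; rewrite mem_filter.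
    by move=> /andP[/asboolP].
  apply/andP; split; first exact/asboolP.
  case: hA => g Gg <-; have [r rs] := sP g Gg.
  rewrite TE => -[l _ /(congr1 (@lin n)) /= /esym /mulg1_eq E].
  by apply/mapP; exists r; rewrite // -E invgK.
- by apply: (@free_abelian_generates n m); rewrite -TE.
move=> hol gens holE gensL; apply: iff_trans (iff_sym copyP).
have holP A : A \in hol <-> (@lin n @` Gam) A by rewrite -holE.
split.
  move=> /hasP[A /holP hA /hasP[B /holP hB]].
  move=> /and5P[/eqP A1 /eqP B1 /eqP AB /eqP BA /(promislow_mx_span _ _ _ _ gensL) sol].
  by exists A, B.
move=> [A [B [[/holP hA A1] [/holP hB B1] AB BA sol]]].
apply/hasP; exists A => //; apply/hasP; exists B => //.
apply/and5P; split; try exact/eqP.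
exact/(promislow_mx_span _ _ _ _ gensL).
Qed.
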